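(* Let $p>1$. For each $\gamma>\frac{p-1}p$, there exist functions $f,f_k\in\mathcal{S}_1(\mathbb{T})\cap L_p(\mathbb{T})$, $k=1,2,\ldots$, such that $$\|f-f_k\|_{L_1}\to0\quad\text{and}\quad\|\log f-\log f_k\|_{L_1}\to0\quad(k\to\infty),$$ while $$\frac{\|f^+-f_k^+\|_{H_2}^2}{\|\log f-\log f_k\|_{L_1}^\gamma}\to\infty\quad(k\to\infty).$$
   Context: $\mathbb{T}=\{|z|=1\}$ and $\|f\|_{L_p}=\left(\frac1{2\pi}\int_0^{2\pi}|f(e^{i\theta})|^p\,d\theta\right)^{1/p}$. $\mathcal{S}_1(\mathbb{T})$ is the set of $f\in L_1(\mathbb{T})$ with $f>0$ a.e. and $\log f\in L_1(\mathbb{T})$. For $f\in\mathcal{S}_1(\mathbb{T})$ the spectral factor is the outer function $$f^+(z)=\exp\left(\frac1{4\pi}\int_0^{2\pi}\frac{e^{i\theta}+z}{e^{i\theta}-z}\log f(e^{i\theta})\,d\theta\right),\quad|z|<1,$$ which belongs to the Hardy space $H_2$ of the unit disk and satisfies $f=|f^+|^2$ a.e. on $\mathbb{T}$. $\|\cdot\|_{H_2}$ is the $L_2(\mathbb{T})$ norm of the boundary function, taken with respect to the normalized measure $\frac{1}{2\pi}d\theta$, i.e. $\|h\|_{H_2}=\left(\frac1{2\pi}\int_0^{2\pi}|h(e^{i\theta})|^2\,d\theta\right)^{1/2}$. *)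

(* Defs.v *)
From HB Require Import structures.
From mathcomp Require Import all_boot all_order all_algebra.
From mathcomp Require Import complex.
From mathcomp Require Import all_classical all_reals all_analysis.

Set Implicit Arguments.
Unset Strict Implicit.
Unset Printing Implicit Defensive.
Import Order.TTheory GRing.Theory Num.Theory.
Import numFieldNormedType.Exports.
Local Open Scope classical_set_scope.
Local Open Scope complex_scope.
Local Open Scope ring_scope.

Section CircleFunctions.
Context {R : realType}.
Implicit Types (f : R[i] -> R) (h : R[i] -> R[i]) (z : R[i]) (t p : R).

Definition cexp z : R[i] :=
  (expR (complex.Re z))%:C * (cos (complex.Im z) +i* sin (complex.Im z)).

Definition expi t : R[i] := cos t +i* sin t.

Lemma two_pi_gt0 : (0 : R) < 2 * pi.
Proof. by rewrite mulr_gt0// pi_gt0. Qed.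

(* The probability d(theta) / (2 pi) on [0, 2 pi]: a function f on the unit
   circle is studied through t |-> f (expi t), so the values of
   f : R[i] -> R off the circle never matter. *)
Definition circle_prob : probability (measurableTypeR R) R :=
  uniform_prob two_pi_gt0.

Definition memLp p f : Prop := (f \o expi) \in Lfun circle_prob p%:E.

Definition memS1 f : Prop :=
  [/\ memLp 1 f, {ae circle_prob, forall t, 0 < f (expi t)}
    & memLp 1 (fun z => ln (f z))].

Definition normLp p f : \bar R := 'N[circle_prob]_(p%:E)[EFin \o (f \o expi)]%E.

Definition cintegral (D : set R) (F : R -> R[i]) : R[i] :=
  (\int[lebesgue_measure]_(t in D) complex.Re (F t))
  +i* (\int[lebesgue_measure]_(t in D) complex.Im (F t)).

Definition spectral_factor f z : R[i] :=
  cexp ((4 * pi)^-1%:C *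
    cintegral `[0, 2 * pi]
      (fun t => (expi t + z) / (expi t - z) * (ln (f (expi t)))%:C)).

(* The boundary function, as the radial limit; it exists almost everywhere for
   h in the Hardy space H_2 of the disk. R[i]^o is R[i] with the topology of
   its modulus. *)
Definition boundary h t : R[i]^o :=
  lim ((h (r%:C * expi t) : R[i]^o) @[r --> (1 : R)^'-]).

Definition normH2 h : \bar R :=
  'N[circle_prob]_2[EFin \o (fun t => Normc.normc (boundary h t))]%E.

End CircleFunctions.

(* Main.v *)
Require Import Defs.
From HB Require Import structures.
From mathcomp Require Import all_boot all_order all_algebra.
From mathcomp Require Import complex.
From mathcomp Require Import all_classical all_reals all_analysis.
From mathcomp Require Import measurable_realfun.
From mathcomp Require Import ring lra.

Import Order.TTheory GRing.Theory Num.Theory.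
Import numFieldNormedType.Exports.
Local Open Scope classical_set_scope.
Local Open Scope complex_scope.
Local Open Scope ring_scope.

(** The [L_1] distance of two logarithms only sees how much of the circle has
    been altered, whereas the [H_2] distance of the spectral factors weighs the
    altered part with the function itself.  So let [f] have a peak and alter it
    near the top.  With [d] the angular distance to the point -1, take
    [f = d ^ (- sigma)] and let [f_k] be [f] multiplied by [e] on the arcs
    [0 < d < w_k], where [w_k = e ^ (- k)].  Then [log f] and [log f_k] are at
    distance exactly [w_k / pi] ([normLp_log_peak]).  On the boundary [f^+] and
    [f_k^+] have moduli [sqrt f] and [sqrt f_k], so on the arcs
    [|f^+ - f_k^+| >= (sqrt e - 1) * sqrt f >= w_k ^ (- sigma / 2) / 2], and the
    squared [H_2] distance is at least [w_k ^ (- sigma) * (w_k / pi) / 4]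
    ([normH2_peak_ge]).  The quotient of the theorem therefore grows at least
    like [w_k ^ (1 - sigma - gamma)], which tends to infinity as soon as
    [1 - gamma < sigma].  Membership in [L_p] asks for [sigma * p < 1], and
    there is room for such a [sigma] because [1 - gamma < 1 / p] is the
    hypothesis on [gamma].

    The analytic content is the modulus of the boundary values, which are
    radial limits.  Write [u = log f] and fix an angle [t] near which [u] is
    Lipschitz.  On the radius at [t], the real and imaginary parts of the
    kernel [(e^is + z) / (e^is - z)] are the Poisson kernel and its conjugate;
    their integrals over the circle are [2 * pi] and 0, both by an explicit
    primitive.  Subtracting the constant [u t] from [u] leaves an integrand
    dominated uniformly in the radius, because the kernels are at most of the
    order of [1 / |s - t|], so the limit can be taken under the integral
    ([schwarz_integral_cvg]).  The Poisson part tends to [2 * pi * u t], which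
    fixes the modulus of the limit as [exp (u t / 2)]; the conjugate part tends
    to some number that only affects the phase ([spectral_factor_radial_limit]).

    For the functions above this applies at all but finitely many points of the
    circle.  Two-sided bounds on the modulus of the boundary function off a null
    set are enough to bound its [H_2] norm from below ([normH2_ge]), since the
    integral of a nonnegative function is a supremum over the simple functions
    below it and hence monotone even for functions not known to be measurable.
    The upper bound matters too: it keeps the norm finite. *)

(** * The Schwarz kernel on a radius *)

(** The squared distance between [e^(ix)] and [r]: the common denominator of
    the real and imaginary parts of the kernel. *)
Definition schwarz_den {R : realType} (r x : R) : R := 1 + r ^+ 2 - 2 * r * cos x.
Definition poisson {R : realType} (r x : R) : R := (1 - r ^+ 2) / schwarz_den r x.
(** Minus the usual conjugate Poisson kernel: the sign is the one with which
    the imaginary part of the kernel occurs below. *)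
Definition schwarz_im {R : realType} (r x : R) : R :=
  - (2 * r) * sin x / schwarz_den r x.

Section Kernel.
Context {R : realType}.
Implicit Types (r s t x : R).

(** This form separates the distance to the circle from the angular distance,
    and is the source of all the lower bounds on the denominator. *)
Lemma schwarz_denE r x : schwarz_den r x = (1 - r) ^+ 2 + 2 * r * (1 - cos x).
Proof. by rewrite /schwarz_den; ring. Qed.

(** Multiply the numerator by the conjugate of the denominator. *)
Lemma schwarz_kernelE r s t :
  (expi s + r%:C * expi t) / (expi s - r%:C * expi t) =
  poisson r (s - t) +i* schwarz_im r (s - t).
Proof.
rewrite /expi /poisson /schwarz_im.
have E : (cos s - r * cos t) ^+ 2 + (sin s - r * sin t) ^+ 2 = schwarz_den r (s - t).
  rewrite /schwarz_den cosB.
  have := cos2Dsin2 s; have := cos2Dsin2 t => h1 h2.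
  transitivity ((cos s ^+ 2 + sin s ^+ 2) + r ^+ 2 * (cos t ^+ 2 + sin t ^+ 2)
    - 2 * r * (cos s * cos t + sin s * sin t)); first by ring.
  by rewrite h1 h2; ring.
have N : (1 - r ^+ 2) = (cos s + r * cos t) * (cos s - r * cos t) +
    (sin s + r * sin t) * (sin s - r * sin t).
  transitivity ((cos s ^+ 2 + sin s ^+ 2) - r ^+ 2 * (cos t ^+ 2 + sin t ^+ 2)).
    by rewrite !cos2Dsin2; ring.
  by ring.
rewrite N sinB -E.
apply/eqP; rewrite eq_complex /= !mul0r !subr0 !addr0.
apply/andP; split; apply/eqP; ring.
Qed.

Lemma schwarz_den_gt0 r x : `|r| < 1 -> 0 < schwarz_den r x.
Proof.
move=> r1; have c1 : `|cos x| <= 1 by rewrite ler_norml cos_geN1 cos_le1.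
have : r * cos x <= `|r|.
  by rewrite (le_trans (ler_norm _))// normrM ler_piMr.
have -> : schwarz_den r x = (1 - `|r|) ^+ 2 + 2 * (`|r| - r * cos x).
  by rewrite /schwarz_den sqrrB real_normK ?num_real//; ring.
have : 0 < (1 - `|r|) ^+ 2 by rewrite exprn_gt0// subr_gt0.
lra.
Qed.

Lemma is_derive_schwarz_den r t x :
  is_derive x 1 (fun s => schwarz_den r (s - t)) (2 * r * sin (x - t)).
Proof.
rewrite /schwarz_den.
apply: is_derive_eq.
rewrite /GRing.scale/=. ring.
Qed.

Lemma Rintegral_is_derive (F f : R -> R) (a b : R) : a < b ->
  continuous f -> (forall x, is_derive x 1 F (f x)) ->
  \int[lebesgue_measure]_(x in `[a, b]) f x = F b - F a.
Proof.
move=> ab cf dF.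
have cF : continuous F.
  move=> x; apply: differentiable_continuous; apply/derivable1_diffP.
  exact: (@ex_derive _ _ _ _ _ _ _ (dF x)).
rewrite /Rintegral (@continuous_FTC2 _ f F)//.
- exact/continuous_subspaceT.
- split.
  + by move=> x _; exact: (@ex_derive _ _ _ _ _ _ _ (dF x)).
  + exact/cvg_at_right_filter/cF.
  + exact/cvg_at_left_filter/cF.
- by move=> x _; rewrite derive1E; exact: (@derive_val _ _ _ _ _ _ _ (dF x)).
Qed.

Lemma continuous_schwarz_den r t : continuous (fun s => schwarz_den r (s - t)).
Proof.
move=> x; apply: differentiable_continuous; apply/derivable1_diffP.
by have := is_derive_schwarz_den r t x => ?.
Qed.

Lemma continuous_poisson r t : `|r| < 1 -> continuous (fun s => poisson r (s - t)).
Proof.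
move=> r1 x; apply: cvgM; first exact: cvg_cst.
apply: cvgV; first by rewrite gt_eqF// schwarz_den_gt0.
exact: continuous_schwarz_den.
Qed.

Lemma continuous_schwarz_im r t : `|r| < 1 ->
  continuous (fun s => schwarz_im r (s - t)).
Proof.
move=> r1 x; apply: cvgM; last first.
  apply: cvgV; first by rewrite gt_eqF// schwarz_den_gt0.
  exact: continuous_schwarz_den.
apply: cvgM; first exact: cvg_cst.
apply: (@continuous_comp _ _ _ (fun s => s - t) sin); last exact: continuous_sin.
by apply: cvgB; [exact: cvg_id|exact: cvg_cst].
Qed.

(** The primitive comes from the harmonic conjugate of [log |1 - z|]: the
    argument of [1 - r e^(ix)] is [- atan (r sin x / (1 - r cos x))], a smooth
    function on the whole line because [r cos x < 1].  Its derivative is half of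
    [1 - poisson r x], and it is periodic, so only the linear term of the
    primitive contributes. *)
Lemma Rintegral_poisson r t : `|r| < 1 ->
  \int[lebesgue_measure]_(s in `[0, 2 * pi]) poisson r (s - t) = 2 * pi.
Proof.
move=> r1.
have pos x : 0 < 1 - r * cos x.
  have c1 : `|cos x| <= 1 by rewrite ler_norml cos_geN1 cos_le1.
  have : r * cos x <= `|r|.
    by rewrite (le_trans (ler_norm _))// normrM ler_piMr.
  lra.
pose a x := r * sin (x - t) / (1 - r * cos (x - t)).
pose F x := (x - t) + 2 * atan (a x).
have dF x : is_derive x 1 F (poisson r (x - t)).
  have p0 := pos (x - t).
  have dq : is_derive x 1 (fun s => (1 - r * cos (s - t))^-1)
     (- (1 - r * cos (x - t)) ^- 2 *: (r * sin (x - t))).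
    apply: is_deriveV; first by rewrite gt_eqF.
    by apply: is_derive_eq; rewrite /GRing.scale/=; ring.
  have da : is_derive x 1 a
      ((r * cos (x - t) - r ^+ 2) / (1 - r * cos (x - t)) ^+ 2).
    apply: is_derive_eq; rewrite /GRing.scale/=.
    have alg (C S : R) : 0 < 1 - r * C -> C ^+ 2 + S ^+ 2 = 1 ->
        r * S * (- (1 - r * C) ^- 2 * (r * S)) + (1 - r * C)^-1 * (r * (C * (1 - 0))) =
        (r * C - r ^+ 2) / (1 - r * C) ^+ 2.
      move=> q0 CS; have -> : r ^+ 2 = r ^+ 2 * (C ^+ 2 + S ^+ 2) by rewrite CS mulr1.
      by field; rewrite gt_eqF.
    exact: alg p0 (cos2Dsin2 _).
  apply: is_derive_eq; rewrite /GRing.scale/= /a /poisson.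
  have d0 := schwarz_den_gt0 r (x - t) r1.
  have alg (C S : R) : 0 < 1 - r * C -> C ^+ 2 + S ^+ 2 = 1 -> 0 < 1 + r ^+ 2 - 2 * r * C ->
      1 + 2 * ((1 + (r * S / (1 - r * C)) ^+ 2)^-1 *
               ((r * C - r ^+ 2) / (1 - r * C) ^+ 2)) =
      (1 - r ^+ 2) / (1 + r ^+ 2 - 2 * r * C).
    move=> q0 CS D0.
    have -> : 1 + (r * S / (1 - r * C)) ^+ 2 =
        (1 + r ^+ 2 - 2 * r * C) / (1 - r * C) ^+ 2.
      have -> : r ^+ 2 = r ^+ 2 * (C ^+ 2 + S ^+ 2) by rewrite CS mulr1.
      by field; rewrite gt_eqF.
    by field; rewrite !gt_eqF.
  by rewrite subr0; exact: alg p0 (cos2Dsin2 _) d0.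
rewrite (Rintegral_is_derive F _ _ _ (@two_pi_gt0 R) (continuous_poisson r t r1) dF).
have aE : a (2 * pi) = a 0.
  by rewrite /a mulr_natl addrC sinD2pi cosD2pi sub0r.
by rewrite /F aE; ring.
Qed.

(** The kernel is the derivative of minus the logarithm of its denominator,
    which is periodic. *)
Lemma Rintegral_schwarz_im r t : `|r| < 1 ->
  \int[lebesgue_measure]_(s in `[0, 2 * pi]) schwarz_im r (s - t) = 0.
Proof.
move=> r1.
pose F x := - ln (schwarz_den r (x - t)).
have dF x : is_derive x 1 F (schwarz_im r (x - t)).
  have d0 := schwarz_den_gt0 r (x - t) r1.
  have dd := is_derive_schwarz_den r t x.
  have dl := is_derive1_ln d0.
  by apply: is_derive_eq; rewrite /schwarz_im mulrC; ring.
rewrite (Rintegral_is_derive F _ _ _ (@two_pi_gt0 R) (continuous_schwarz_im r t r1) dF).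
by rewrite /F /schwarz_den !mulr_natl [pi *+ 2 - t]addrC cosD2pi sub0r subrr.
Qed.

End Kernel.

(** * Size of the kernel near the singular angle *)

Section RadialLimit.
Context {R : realType}.
Implicit Types (r s t x : R) (u : R -> R).
Local Notation mu := (@lebesgue_measure R).

Lemma onem_cos_ge_near0 :
  exists2 d : R, 0 < d & forall x, `|x| < d -> x ^+ 2 / 8 <= 1 - cos x.
Proof.
have : \forall x \near (0 : R), 2^-1 < cos x.
  apply: (@cvgr_gt _ _ _ (nbhs_filter _) cos (cos 0)); last by rewrite cos0; lra.
  exact: continuous_cos.
move=> [d /= d0 dcos]; exists d => // x xd.
rewrite -(cos_norm x) -(real_normK (num_real x)).
move: (normr_ge0 x) xd; move: `|x| => {}x; rewrite le_eqVlt => /predU1P[<- _|x0 xd].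
  by rewrite cos0; lra.
have x20 : 0 < x / 2 by lra.
have [|c /[!in_itv]/= /andP[c0 cx]] := MVT x20 (fun y _ => is_derive_sin y).
  by apply: continuous_subspaceT => y; exact: continuous_sin.
rewrite sin0 !subr0 => sE.
have cc : 2^-1 < cos c.
  by apply: dcos => /=; rewrite sub0r normrN gtr0_norm//; lra.
have -> : 1 - cos x = 2 * sin (x / 2) ^+ 2.
  have -> : x = (x / 2) *+ 2 by rewrite -mulr_natr; field.
  rewrite cos_mulr2n; have := cos2Dsin2 (x / 2 *+ 2 / 2).
  have -> : x / 2 *+ 2 / 2 = x / 2 by rewrite -mulr_natr; field.
  rewrite -(mulr_natl _ 2); lra.
rewrite sE.
have : x / 4 <= cos c * (x / 2) by nra.
nra.
Qed.

Lemma cos_le_far (d x : R) : 0 <= d <= pi -> d <= `|x| <= 2 * pi - d -> cos x <= cos d.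
Proof.
move=> /andP[d0 dpi]; rewrite -(cos_norm x); move: `|x| => y /andP[dy yd].
have le_cos (a b : R) : 0 <= a -> a <= b -> b <= pi -> cos b <= cos a.
  move=> a0; rewrite le_eqVlt => /predU1P[<-//|ab] bpi.
  by rewrite ltW// ltr_cos// in_itv/=; apply/andP; split; lra.
have [ypi|piy] := leP y pi; first exact: le_cos.
have -> : cos y = cos (2 * pi - y).
  by rewrite mulr_natl -(cosN y) -(cosD2pi (- y)) addrC.
by apply: le_cos; lra.
Qed.

(** Two regimes: near [t] the quadratic behaviour of the cosine at 0, and away
    from it the strict bound [cos < 1].  As [t] is an interior point, [s - t]
    stays away from [2 * pi] and [- 2 * pi], where [1 - cos] vanishes again. *)
Lemma onem_cos_ge t : 0 < t < 2 * pi -> exists2 c : R, 0 < c &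
  forall s, s \in `[0, 2 * pi] -> c * (s - t) ^+ 2 <= 1 - cos (s - t).
Proof.
move=> /andP[t0 t2pi].
have pi0 := pi_gt0 R.
have [d0 d00 near0] := onem_cos_ge_near0.
pose d := Num.min (Num.min d0 pi) (Num.min t (2 * pi - t)).
have d_gt0 : 0 < d by rewrite /d !lt_min d00 pi0 t0 subr_gt0.
have [dd0 dpi dt dt'] : [/\ d <= d0, d <= pi, d <= t & d <= 2 * pi - t].
  by rewrite /d !ge_min !lexx !orbT.
have cosd : cos d < 1 by rewrite -cos0 ltr_cos ?in_itv/= ?lexx ?(ltW pi0) ?(ltW d_gt0).
have pp : 0 < (2 * pi) ^+ 2 :> R by rewrite exprn_gt0// mulr_gt0.
exists (Num.min 8^-1 ((1 - cos d) / (2 * pi) ^+ 2)).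
  by rewrite lt_min invr_gt0 ltr0n/= divr_gt0// subr_gt0.
move=> s /[!in_itv]/= /andP[s0 s2pi].
have [sd|ds] := ltP `|s - t| d.
  apply: le_trans (near0 (s - t) (lt_le_trans sd dd0)).
  by rewrite mulrC ler_wpM2l ?sqr_ge0// ge_min lexx.
apply: (@le_trans _ _ (1 - cos d)); last first.
  rewrite lerB//; apply: cos_le_far; first by rewrite ltW.
  by rewrite ds/= ler_norml; apply/andP; split; lra.
apply: (@le_trans _ _ ((1 - cos d) / (2 * pi) ^+ 2 * (s - t) ^+ 2)).
  by rewrite ler_wpM2r ?sqr_ge0// ge_min lexx orbT.
rewrite mulrAC ler_pdivrMr// ler_wpM2l ?subr_ge0 ?cos_le1//.
by rewrite -(real_normK (num_real (s - t))) lerXn2r ?nnegrE ?normr_ge0//;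
  [lra|rewrite ler_norml; apply/andP; split; lra].
Qed.

(** Both kernels are of the order of [1 / |s - t|], uniformly in the radius.  The
    Poisson kernel is [|1 - r| (1 + r)] over a quantity comparable to
    [(1 - r)^2 + (s - t)^2], and the arithmetic-geometric inequality bounds the
    latter below by a multiple of [|1 - r| |s - t|]; the conjugate kernel is
    handled through [sin^2 <= 2 (1 - cos)].  Radii beyond 1 are included so that
    1 is an interior point when continuity in the radius is used. *)
Lemma schwarz_kernel_bound t : 0 < t < 2 * pi -> exists M : R,
  forall s r, s \in `[0, 2 * pi] -> r \in `]2^-1, 3 / 2[ ->
    `|poisson r (s - t)| * `|s - t| <= M /\
    `|schwarz_im r (s - t)| * `|s - t| <= M.
Proof.
move=> /onem_cos_ge[c c0 cP].
pose m := Num.min 1 c.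
have m0 : 0 < m by rewrite lt_min ltr01.
have [m1 mc] : m <= 1 /\ m <= c by rewrite !ge_min !lexx orbT.
exists (6 / (4 * m)) => s r sI /[!in_itv]/= /andP[r12 r32].
have [->|st] := eqVneq s t.
  by rewrite subrr normr0 !mulr0; split; rewrite divr_ge0//; lra.
have := cP s sI.
have : 0 < (s - t) ^+ 2 by rewrite exprn_even_gt0// subr_eq0.
rewrite /poisson /schwarz_im !normrM normrN !normrM !normfV.
have := sin2cos2 (s - t).
rewrite -(real_normK (num_real (s - t))) -(real_normK (num_real (sin _))).
have := cos_geN1 (s - t); have := cos_le1 (s - t).
have := normr_ge0 (s - t); have := normr_ge0 (sin (s - t)).
have := schwarz_denE r (s - t); move: (schwarz_den _ _).
move: `|s - t| `|sin _| (cos _) => x S C D DE S0 x0 C1 CN1 SC x20 xC.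
(* here 2 * r >= 1, so the term 2 * r * (1 - cos) is at least c * (s - t)^2 *)
have Dm : m * ((1 - r) ^+ 2 + x ^+ 2) <= D.
  rewrite DE mulrDr lerD//.
    by rewrite ler_piMl ?sqr_ge0.
  have : m * x ^+ 2 <= c * x ^+ 2 by rewrite ler_wpM2r// ltW.
  nra.
have D0 : 0 < D.
  by apply: lt_le_trans Dm; rewrite mulr_gt0// ltr_wpDl// sqr_ge0.
rewrite (gtr0_norm D0); split.
  rewrite mulrAC ler_pdivrMr// mulrAC ler_pdivlMr; last lra.
  rewrite (_ : 1 - r ^+ 2 = (1 - r) * (1 + r)); last by ring.
  rewrite normrM (ger0_norm (_ : 0 <= 1 + r)); last lra.
  rewrite -(real_normK (num_real (1 - r))) in Dm.
  move: (normr_ge0 (1 - r)) Dm; move: `|1 - r| => e e0 Dm.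
  have h1 : 2 * (e * x) <= e ^+ 2 + x ^+ 2 by have := sqr_ge0 (e - x); nra.
  have h2 : m * (2 * (e * x)) <= D by apply: le_trans Dm; rewrite ler_wpM2l// ltW.
  have h3 : 0 <= e * x by rewrite mulr_ge0.
  have h4 : m * (e * x) * (1 + r) <= m * (e * x) * (5 / 2).
    by rewrite ler_wpM2l ?mulr_ge0 ?(ltW m0)//; lra.
  lra.
rewrite (ger0_norm (_ : 0 <= 2)) ?(ger0_norm (_ : 0 <= r)); [|lra..].
rewrite mulrAC ler_pdivrMr// [leRHS]mulrAC ler_pdivlMr; last lra.
have h1 : 2 * (S * x) <= S ^+ 2 + x ^+ 2 by have := sqr_ge0 (S - x); nra.
have h2 : S ^+ 2 <= 2 * (1 - C) by nra.
have h3 : m * x ^+ 2 <= 1 - C.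
  by apply: le_trans xC; rewrite ler_wpM2r// ltW.
have h4 : 2 * r * (1 - C) <= D by rewrite DE; have := sqr_ge0 (1 - r); lra.
have h5 : m * S ^+ 2 <= S ^+ 2 by rewrite ler_piMl ?sqr_ge0.
have h6 : m * (2 * (S * x)) <= m * S ^+ 2 + m * x ^+ 2.
  by rewrite -mulrDr ler_wpM2l// ltW.
have h7 : m * (2 * (S * x)) <= 3 * (1 - C) by lra.
have : r * (m * (2 * (S * x))) <= r * (3 * (1 - C)) by rewrite ler_wpM2l//; lra.
lra.
Qed.

(** * Radial limits of the Poisson integral and of its conjugate *)

(** The difference [u s - u t] is at most [|s - t|] times a multiple of
    [1 + |u s|]: near [t] by the Lipschitz condition, elsewhere because [|s - t|]
    is bounded below.  The factor [|s - t|] absorbs the singularity of the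
    kernel. *)
Lemma kernel_diff_bound u (k : R -> R -> R) t (I : interval R) (M L : R) :
  (forall s r, s \in `[0, 2 * pi] -> r \in I -> `|k r (s - t)| * `|s - t| <= M) ->
  (\forall s \near t, `|u s - u t| <= L * `|s - t|) ->
  exists K, forall s r, s \in `[0, 2 * pi] -> r \in I ->
    `|k r (s - t) * (u s - u t)| <= K * (1 + `|u s|).
Proof.
move=> kM [e /= e0 uL].
pose K := `|L| + (1 + `|u t|) / e.
have uK s : `|u s - u t| <= `|s - t| * (K * (1 + `|u s|)).
  have [se|es] := ltP `|t - s| e.
    apply: le_trans (uL s se) _; rewrite mulrC ler_wpM2l//.
    apply: (@le_trans _ _ (K * 1)).
      rewrite mulr1 /K ler_wpDr ?ler_norm//.
      by rewrite divr_ge0// ?(ltW e0)// addr_ge0.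
    rewrite ler_wpM2l ?lerDl// /K addr_ge0// divr_ge0// ?(ltW e0)// addr_ge0//.
  apply: (@le_trans _ _ (e * ((1 + `|u t|) / e * (1 + `|u s|)))).
    have -> : e * ((1 + `|u t|) / e * (1 + `|u s|)) = (1 + `|u t|) * (1 + `|u s|).
      by field; rewrite gt_eqF.
    apply: le_trans (ler_normB _ _) _.
    have := normr_ge0 (u s); have := normr_ge0 (u t); nra.
  rewrite distrC in es; rewrite ler_pM//.
  - by rewrite ltW.
  - by rewrite mulr_ge0 ?addr_ge0// divr_ge0 ?addr_ge0// ltW.
  - by rewrite ler_wpM2r ?addr_ge0// /K lerDr.
exists (M * K) => s r sI rI.
rewrite normrM; apply: le_trans (ler_wpM2l (normr_ge0 _) (uK s)) _.
rewrite (mulrA _ `|s - t|) -(mulrA M).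
rewrite ler_wpM2r ?kM// mulr_ge0 ?addr_ge0// /K divr_ge0 ?addr_ge0//.
by rewrite ltW.
Qed.

(** Dominated convergence in the radius.  At [s = t] the kernel may blow up as
    the radius tends to 1, but there the integrand vanishes identically. *)
Lemma kernel_diff_cvg u (k : R -> R -> R) t (L M : R) :
  mu.-integrable `[0, 2 * pi] (EFin \o u) ->
  (\forall s \near t, `|u s - u t| <= L * `|s - t|) ->
  (forall r, r \in `]2^-1, 3 / 2[ -> measurable_fun setT (fun s => k r (s - t))) ->
  (forall s r, s \in `[0, 2 * pi] -> r \in `]2^-1, 3 / 2[ ->
    `|k r (s - t)| * `|s - t| <= M) ->
  (forall s r, s \in `[0, 2 * pi] -> s != t -> r \in `]2^-1, 3 / 2[ ->
    {for r, continuous (fun r => k r (s - t))}) ->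
  (forall r, r \in `]2^-1, 3 / 2[ ->
     mu.-integrable `[0, 2 * pi] (EFin \o (fun s => k r (s - t) * (u s - u t)))) /\
  {for 1, continuous (fun r =>
     \int[mu]_(s in `[0, 2 * pi]) (k r (s - t) * (u s - u t)))}.
Proof.
move=> iu uL mk kM ck.
have [K KP] := kernel_diff_bound u k t _ _ _ kM uL.
have mD : measurable (`[0, 2 * pi]%classic : set R) by exact: measurable_itv.
have mu_ : measurable_fun `[0, 2 * pi] u by apply/measurable_EFinP; exact: measurable_int iu.
have ig : mu.-integrable `[0, 2 * pi] (EFin \o (fun s => K * (1 + `|u s|))).
  have -> : EFin \o (fun s => K * (1 + `|u s|)) =
      (fun s => K%:E * ((EFin \o cst 1%R) \+ (abse \o (EFin \o u)))%E s)%E.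
    by apply/funext => s /=; rewrite EFinM EFinD.
  apply: integrableZl => //; apply: integrableD => //.
    apply: continuous_compact_integrable; first exact: segment_compact.
    by apply: continuous_subspaceT => x; exact: cvg_cst.
  exact: integrable_abse.
have int_f r : r \in `]2^-1, 3 / 2[ ->
     mu.-integrable `[0, 2 * pi] (EFin \o (fun s => k r (s - t) * (u s - u t))).
  move=> rI; apply: le_integrable ig => //.
    apply/measurable_EFinP; apply: measurable_funM.
      by apply: measurable_funTS; exact: mk.
    exact: measurable_funB.
  move=> s sI /=; rewrite lee_fin (le_trans _ (ler_norm _))//.
  by apply: KP => //; rewrite inE.
split=> //.
apply: (@continuity_under_integral _ _ _ mu (fun r s => k r (s - t) * (u s - u t))
  _ mD 2^-1 (3 / 2) _ _ (fun s => K * (1 + `|u s|))) => //.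
- apply: (aeW mu) => s sI r; rewrite inE/= => rI.
  have [->|st] := eqVneq s t.
    rewrite (_ : (fun r => _) = cst 0); first exact: cvg_cst.
    by apply/funext => x; rewrite (subrr (u t)) mulr0.
  by apply: cvgM; [exact: ck|exact: cvg_cst].
- by move=> r rI; apply: (aeW mu) => s sI; exact: KP.
- by rewrite inE/= in_itv/=; apply/andP; split; lra.
Qed.

Lemma measurable_kernel_div (f g : R -> R) :
  measurable_fun setT f -> measurable_fun setT g -> (forall x, 0 <= g x) ->
  measurable_fun setT (fun x => f x / g x).
Proof.
move=> mf mg g0; apply: measurable_funM => //.
(* the real power -1 agrees with the inverse at 0 too, where both are 0 *)
rewrite (_ : (fun x => _) = (fun x => g x `^ (-1))); last first.
  by apply/funext => x; rewrite powR_inv1.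
exact: (measurableT_comp (measurable_powR _)).
Qed.

Lemma schwarz_den_ge0 r x : 0 <= r -> 0 <= schwarz_den r x.
Proof.
by move=> r0; rewrite schwarz_denE addr_ge0 ?sqr_ge0// mulr_ge0 ?mulr_ge0//.
Qed.

Lemma continuous_schwarz_den_l x : continuous (fun r => schwarz_den r x).
Proof.
move=> r; apply: cvgB; last by apply: cvgM; [apply: cvgM|]; [exact: cvg_cst|exact: cvg_id|exact: cvg_cst].
by apply: cvgD; [exact: cvg_cst|exact: exprn_continuous].
Qed.

(** The integral of the kernel against the constant [u t] is computed by the
    primitives, and the integral against [u - u t] is continuous in the radius
    up to 1, where the Poisson kernel vanishes off the singular angle. *)
Lemma schwarz_integral_cvg u t (L : R) : 0 < t < 2 * pi ->
  mu.-integrable `[0, 2 * pi] (EFin \o u) ->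
  (\forall s \near t, `|u s - u t| <= L * `|s - t|) ->
  ((\int[mu]_(s in `[0, 2 * pi]) (poisson r (s - t) * u s))
     @[r --> (1 : R)^'-] --> 2 * pi * u t) /\
  exists b : R, (\int[mu]_(s in `[0, 2 * pi]) (schwarz_im r (s - t) * u s))
     @[r --> (1 : R)^'-] --> b.
Proof.
move=> tI iu uL.
have [M MP] := schwarz_kernel_bound t tI.
have [c c0 cP] := onem_cos_ge t tI.
have den0 s r : s \in `[0, 2 * pi] -> s != t -> r \in `]2^-1, 3 / 2[ ->
    schwarz_den r (s - t) != 0.
  move=> sI st /[!in_itv]/= /andP[r0 _]; rewrite schwarz_denE gt_eqF//.
  rewrite ltr_wpDl ?sqr_ge0// !mulr_gt0//; first lra.
  apply: lt_le_trans (cP _ sI).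
  by rewrite mulr_gt0// exprn_even_gt0// subr_eq0.
have mden r : measurable_fun setT (fun s => schwarz_den r (s - t)).
  by apply: continuous_measurable_fun; exact: continuous_schwarz_den.
have ge0 r s : r \in `]2^-1, 3 / 2[ -> 0 <= schwarz_den r (s - t).
  by move=> /[!in_itv]/= /andP[r0 _]; apply: schwarz_den_ge0; lra.
have [ip cp] : (forall r, r \in `]2^-1, 3 / 2[ ->
     mu.-integrable `[0, 2 * pi] (EFin \o (fun s => poisson r (s - t) * (u s - u t)))) /\
  {for 1, continuous (fun r =>
     \int[mu]_(s in `[0, 2 * pi]) (poisson r (s - t) * (u s - u t)))}.
  refine (kernel_diff_cvg u poisson t L M iu uL _ _ _).
  - by move=> r rI; apply: measurable_kernel_div => // s; exact: ge0.
  - by move=> s r sI rI; exact: (MP s r sI rI).1.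
  - move=> s r sI st rI; apply: cvgM.
      by apply: cvgB; [exact: cvg_cst|exact: exprn_continuous].
    by apply: cvgV; [exact: den0|exact: continuous_schwarz_den_l].
have [iq cq] : (forall r, r \in `]2^-1, 3 / 2[ ->
     mu.-integrable `[0, 2 * pi]
       (EFin \o (fun s => schwarz_im r (s - t) * (u s - u t)))) /\
  {for 1, continuous (fun r =>
     \int[mu]_(s in `[0, 2 * pi]) (schwarz_im r (s - t) * (u s - u t)))}.
  refine (kernel_diff_cvg u schwarz_im t L M iu uL _ _ _).
  - move=> r rI; apply: measurable_kernel_div => //; last by move=> s; exact: ge0.
    apply: measurable_funM => //; apply: continuous_measurable_fun => x.
    apply: (@continuous_comp _ _ _ (fun s => s - t) sin); last exact: continuous_sin.
    by apply: cvgB; [exact: cvg_id|exact: cvg_cst].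
  - by move=> s r sI rI; exact: (MP s r sI rI).2.
  - move=> s r sI st rI; apply: cvgM; last first.
      by apply: cvgV; [exact: den0|exact: continuous_schwarz_den_l].
    apply: cvgM; last exact: cvg_cst.
    by apply: cvgN; apply: cvgM; [exact: cvg_cst|exact: cvg_id].
have near1 : \forall r \near (1 : R)^'-, (r \in `]2^-1, 3 / 2[) /\ (`|r| < 1).
  near=> r; have r1 : r < 1 by near: r; exact: nbhs_left_lt.
  have r2 : 2^-1 < r by near: r; apply: nbhs_left_gt; lra.
  by rewrite in_itv/= r2/= ger0_norm; [split; lra|lra].
have split_int (k : R -> R) : continuous (fun s => k (s - t)) ->
    mu.-integrable `[0, 2 * pi] (EFin \o (fun s => k (s - t) * (u s - u t))) ->
    \int[mu]_(s in `[0, 2 * pi]) (k (s - t) * u s) =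
    u t * \int[mu]_(s in `[0, 2 * pi]) k (s - t) +
    \int[mu]_(s in `[0, 2 * pi]) (k (s - t) * (u s - u t)) :> R.
  move=> ck ik.
  have ic : mu.-integrable `[0, 2 * pi] (EFin \o (fun s => k (s - t))).
    apply: continuous_compact_integrable; first exact: segment_compact.
    exact: continuous_subspaceT.
  rewrite -RintegralZl// -RintegralD//.
    by apply: eq_Rintegral => s _; ring.
  exact: (@integrableZl _ _ _ mu _ (measurable_itv _) (u t) _ ic).
split.
- rewrite (_ : 2 * pi * u t = u t * (2 * pi) +
    \int[mu]_(s in `[0, 2 * pi]) (poisson 1 (s - t) * (u s - u t))); last first.
    rewrite [X in _ + X](_ : _ = \int[mu]_(s in `[0, 2 * pi]) 0).
      by rewrite Rintegral_cst// mul0r addr0 mulrC.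
    by apply: eq_Rintegral => s _; rewrite /poisson expr1n subrr !mul0r.
  have : (u t * (2 * pi) + \int[mu]_(s in `[0, 2 * pi])
      (poisson r (s - t) * (u s - u t))) @[r --> (1 : R)^'-] -->
    u t * (2 * pi) + \int[mu]_(s in `[0, 2 * pi]) (poisson 1 (s - t) * (u s - u t)).
    by apply: cvgD; [exact: cvg_cst|exact/cvg_at_left_filter/cp].
  apply: cvg_trans; apply: near_eq_cvg; apply: filterS near1 => r [rI r1].
  rewrite (split_int (poisson r)) ?Rintegral_poisson//; last exact: ip.
  exact: continuous_poisson.
- exists (\int[mu]_(s in `[0, 2 * pi]) (schwarz_im 1 (s - t) * (u s - u t))).
  have : (\int[mu]_(s in `[0, 2 * pi])
      (schwarz_im r (s - t) * (u s - u t))) @[r --> (1 : R)^'-] -->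
    \int[mu]_(s in `[0, 2 * pi]) (schwarz_im 1 (s - t) * (u s - u t)).
    exact/cvg_at_left_filter/cq.
  apply: cvg_trans; apply: near_eq_cvg; apply: filterS near1 => r [rI r1].
  rewrite (split_int (schwarz_im r)) ?Rintegral_schwarz_im ?mulr0 ?add0r//; last exact: iq.
  exact: continuous_schwarz_im.
Unshelve. all: by end_near. Qed.

(** * Boundary values of the spectral factor *)

(** Convergence for the modulus follows from that of both coordinates, as
    [|z| <= |Re z| + |Im z|]. *)
Lemma cvg_complex (T : Type) (F : set_system T) (FF : Filter F) (g : T -> R[i]) (a b : R) :
  complex.Re (g x) @[x --> F] --> a -> complex.Im (g x) @[x --> F] --> b ->
  (g x : R[i]^o) @[x --> F] --> (a +i* b : R[i]^o).
Proof.
move=> ga gb; apply/cvgrPdist_lt => e; rewrite ltcE/= => /andP[/eqP e_im e_re].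
have e2 : 0 < complex.Re e / 2 by rewrite divr_gt0.
move/cvgrPdist_lt : ga => /(_ _ e2) ga; move/cvgrPdist_lt : gb => /(_ _ e2) gb.
near=> x.
have gax : `|a - complex.Re (g x)| < complex.Re e / 2 by near: x.
have gbx : `|b - complex.Im (g x)| < complex.Re e / 2 by near: x.
rewrite normc_def ltcE/= e_im eqxx/=.
case: (g x) gax gbx => c d /= gax gbx.
apply: (@le_lt_trans _ _ (`|a - c| + `|b - d|)); last lra.
rewrite -(ger0_norm (_ : 0 <= `|a - c| + `|b - d|)) ?addr_ge0// -sqrtr_sqr ler_wsqrtr//.
by rewrite [leRHS]sqrrD !real_normK ?num_real// addrAC lerDl mulrn_wge0 ?mulr_ge0.
Unshelve. all: by end_near. Qed.

Lemma normc_sub_bounds (x y : R[i]) :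
  `|Normc.normc x - Normc.normc y| <= Normc.normc (x - y) <= Normc.normc x + Normc.normc y.
Proof.
have tri (z w : R[i]) : Normc.normc z <= Normc.normc (z - w) + Normc.normc w.
  by rewrite -{1}(subrK w z) le_normcD.
rewrite -[X in _ <= _ + X]normcN le_normcD andbT ler_norml.
have := tri x y; have := tri y x; rewrite -(normcN (x - y)) opprB.
by move=> h1 h2; apply/andP; split; lra.
Qed.

Lemma spectral_factor_radialE (f : R[i] -> R) r t :
  let a := (\int[mu]_(s in `[0, 2 * pi]) (poisson r (s - t) * ln (f (expi s)))) / (4 * pi) in
  let b := (\int[mu]_(s in `[0, 2 * pi]) (schwarz_im r (s - t) * ln (f (expi s)))) / (4 * pi) in
  spectral_factor f (r%:C * expi t) = (expR a * cos b) +i* (expR a * sin b).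
Proof.
rewrite /spectral_factor.
set C := cintegral _ _.
have -> : C = (\int[mu]_(s in `[0, 2 * pi]) (poisson r (s - t) * ln (f (expi s)))) +i*
    (\int[mu]_(s in `[0, 2 * pi]) (schwarz_im r (s - t) * ln (f (expi s)))).
  rewrite /C /cintegral; congr (_ +i* _).
    by apply: eq_Rintegral => s _; rewrite schwarz_kernelE/= mulr0 subr0.
  by apply: eq_Rintegral => s _; rewrite schwarz_kernelE/= mulr0 add0r.
rewrite /cexp/= !mul0r !subr0 !addr0.
by apply/eqP; rewrite !(mulrC (4 * pi)^-1) eq_complex/= !mul0r subr0 addr0 !eqxx.
Qed.

(** The exponent of the spectral factor has the real part
    [(4 * pi)^-1 * (2 * pi * u t) = u t / 2] in the limit; its imaginary part
    converges as well, and only rotates the value. *)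
Lemma spectral_factor_radial_limit (f : R[i] -> R) t (L : R) : 0 < t < 2 * pi ->
  mu.-integrable `[0, 2 * pi] (EFin \o (fun s => ln (f (expi s)))) ->
  (\forall s \near t, `|ln (f (expi s)) - ln (f (expi t))| <= L * `|s - t|) ->
  exists2 b : R[i],
    (spectral_factor f (r%:C * expi t) : R[i]^o) @[r --> (1 : R)^'-] --> (b : R[i]^o) &
    Normc.normc b = expR (ln (f (expi t)) / 2).
Proof.
move=> tI iu uL.
have [cA [B cB]] := schwarz_integral_cvg (fun s => ln (f (expi s))) t L tI iu uL.
have pi0 := pi_gt0 R.
set v := ln (f (expi t)) / 2.
exists ((expR v * cos (B / (4 * pi))) +i* (expR v * sin (B / (4 * pi)))); last first.
  by rewrite /= !exprMn -mulrDr cos2Dsin2 mulr1 sqrtr_sqr ger0_norm//.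
have vE : v = 2 * pi * ln (f (expi t)) / (4 * pi).
  by rewrite /v; move: pi0; move: (pi : R) (ln _) => q y q0; field; rewrite gt_eqF.
have {}cA : (\int[mu]_(s in `[0, 2 * pi]) (poisson r (s - t) * ln (f (expi s)))) / (4 * pi)
    @[r --> (1 : R)^'-] --> v.
  by rewrite vE; apply: cvgM; [exact: cA|exact: cvg_cst].
have {}cB : (\int[mu]_(s in `[0, 2 * pi]) (schwarz_im r (s - t) * ln (f (expi s)))) / (4 * pi)
    @[r --> (1 : R)^'-] --> B / (4 * pi).
  by apply: cvgM; [exact: cB|exact: cvg_cst].
under eq_cvg => r do rewrite spectral_factor_radialE.
have cE := cvg_comp _ _ cA (@continuous_expR R v).
apply: cvg_complex => /=.
  exact: (cvgM cE (cvg_comp _ _ cB (@continuous_cos R _))).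
exact: (cvgM cE (cvg_comp _ _ cB (@continuous_sin R _))).
Qed.

(** Only the moduli of the two limits are known, so their difference is estimated
    as if the phases agreed, from below, or were opposite, from above. *)
Lemma boundary_sub (f g : R[i] -> R) t (L : R) : 0 < t < 2 * pi ->
  mu.-integrable `[0, 2 * pi] (EFin \o (fun s => ln (f (expi s)))) ->
  mu.-integrable `[0, 2 * pi] (EFin \o (fun s => ln (g (expi s)))) ->
  (\forall s \near t, `|ln (f (expi s)) - ln (f (expi t))| <= L * `|s - t|) ->
  (\forall s \near t, `|ln (g (expi s)) - ln (g (expi t))| <= L * `|s - t|) ->
  `|expR (ln (f (expi t)) / 2) - expR (ln (g (expi t)) / 2)|
  <= Normc.normc (boundary (fun z => spectral_factor f z - spectral_factor g z) t)
  <= expR (ln (f (expi t)) / 2) + expR (ln (g (expi t)) / 2).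
Proof.
move=> tI iF iG fL gL.
have [b cb <-] := spectral_factor_radial_limit f t L tI iF fL.
have [c cc <-] := spectral_factor_radial_limit g t L tI iG gL.
rewrite /boundary (cvg_lim _ (cvgB cb cc)); last exact: norm_hausdorff.
exact: normc_sub_bounds.
Qed.

End RadialLimit.

(** * Powers of the angular distance to -1 *)

(** As [- cos t = cos (t - pi)], this is the length of the shorter arc from [z]
    to -1 when [z] is on the circle.  Placing the singularity at -1 makes it an
    interior point of the interval of angles from 0 to [2 * pi]. *)
Definition angle_to_N1 {R : realType} (z : R[i]) : R := acos (- complex.Re z).

Section Distance.
Context {R : realType}.
Implicit Types (s t x : R).
Local Notation mu := (@lebesgue_measure R).

Lemma Ncos_itv t : -1 <= - cos t <= 1.
Proof. by rewrite lerN2 cos_le1 lerNl cos_geN1. Qed.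

Lemma angle_to_N1_expi t : 0 <= t <= 2 * pi -> angle_to_N1 (expi t) = `|t - pi|.
Proof.
move=> /andP[t0 t2pi]; rewrite /angle_to_N1/=.
have -> : - cos t = cos `|t - pi|.
  by rewrite cos_norm cosB cospi sinpi mulr0 addr0 mulrN1.
by rewrite cosK// in_itv/= normr_ge0 ler_norml; apply/andP; split; lra.
Qed.

Lemma angle_to_N1_expi_itv t : 0 <= angle_to_N1 (expi t) <= pi.
Proof. by rewrite acos_ge0 ?acos_lepi ?Ncos_itv. Qed.

Lemma measurable_angle_to_N1 : measurable_fun setT (fun t => angle_to_N1 (expi t)).
Proof.
move=> mT; apply: (measurability _ (RGenOInfty.measurableE R)) => //.
move=> /= _ [_ [x ->] <-]; rewrite setTI.
have [x0|x0] := ltP x 0.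
  rewrite (_ : _ @^-1` _ = setT)//; apply/seteqP; split=> // t _ /=.
  have /andP[d0 _] := angle_to_N1_expi_itv t.
  by rewrite in_itv/= andbT (lt_le_trans x0).
have [xpi|xpi] := leP pi x.
  rewrite (_ : _ @^-1` _ = set0)//; apply/seteqP; split=> // t /=.
  have /andP[_ dpi] := angle_to_N1_expi_itv t.
  by rewrite in_itv/= andbT ltNge (le_trans dpi).
rewrite (_ : _ @^-1` _ = (fun t => - cos t) @^-1` `]-oo, cos x[%classic).
  rewrite -[X in measurable X]setTI.
  have : measurable_fun setT (fun t : R => - cos t).
    apply: continuous_measurable_fun => t; apply: cvgN; exact: continuous_cos.
  by apply => //; exact: measurable_itv.
apply/seteqP; split=> t /=; rewrite !in_itv/= andbT.
all: have /andP[d0 dpi] := angle_to_N1_expi_itv t.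
all: have <- : cos (angle_to_N1 (expi t)) = - cos t by rewrite acosK// in_itv/= Ncos_itv.
all: by rewrite ltr_cos// in_itv/= ?d0 ?dpi// x0 ltW.
Qed.

(** The number [e], 1 or -1, selects the side of [pi], so that one primitive
    serves both.  The bound does not depend on how close the interval comes to
    [pi]. *)
Lemma integral_power_off_pi (a c d e : R) : a < 1 -> c < d -> e ^+ 2 = 1 ->
  0 < e * (c - pi) <= pi -> 0 < e * (d - pi) <= pi ->
  (\int[mu]_(s in `[c, d]) (expR (- a * ln (e * (s - pi))))%:E <=
    (expR ((1 - a) * ln pi) / (1 - a))%:E)%E.
Proof.
move=> a1 cd e2 /andP[c0 cpi] /andP[d0 dpi].
have a10 : 0 < 1 - a by rewrite subr_gt0.
have y0 s : s \in `[c, d] -> 0 < e * (s - pi).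
  move=> /[!in_itv]/= /andP[cs sd].
  have [e_gt0|e_lt0] := ltP 0 e.
    by apply: lt_le_trans c0 _; rewrite ler_wpM2l ?(ltW e_gt0)// lerB.
  by apply: lt_le_trans d0 _; rewrite ler_wnM2l// lerB.
pose F s := e / (1 - a) * expR ((1 - a) * ln (e * (s - pi))).
have dF s : s \in `[c, d] -> is_derive s 1 F (expR (- a * ln (e * (s - pi)))).
  move=> /y0 ys.
  have dl := is_derive1_ln ys.
  have dc : is_derive s 1 (fun s => ln (e * (s - pi))) ((e * (s - pi))^-1 * e).
    have dy : is_derive s 1 (fun s => e * (s - pi)) e.
      by apply: is_derive_eq; rewrite /GRing.scale/= subr0 mulr1.
    exact: (@is_derive1_comp _ (@ln R) (fun s => e * (s - pi)) s _ _ dl dy).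
  apply: is_derive_eq; rewrite /GRing.scale/=.
  have -> : - a * ln (e * (s - pi)) = (1 - a) * ln (e * (s - pi)) - ln (e * (s - pi)) by ring.
  rewrite expRB [expR (ln _)]lnK ?posrE//.
  move: ys; move: (e * (s - pi)) => y ys.
  have alg (E : R) : e / (1 - a) * (E * ((1 - a) * (y^-1 * e))) = E / y.
    by transitivity (e ^+ 2 * (E / y)); [field; rewrite !gt_eqF|rewrite e2 mul1r].
  exact: alg.
have dF1 s : s \in `[c, d] -> derivable F s 1.
  by move=> /dF h; exact: ex_derive.
have cF s : s \in `[c, d] -> {for s, continuous F}.
  by move=> sI; apply: differentiable_continuous; apply/derivable1_diffP/dF1.
have cI : c \in `[c, d] by rewrite in_itv/= lexx ltW.
have dI : d \in `[c, d] by rewrite in_itv/= lexx ltW.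
rewrite (@continuous_FTC2 _ _ F)//.
- rewrite -EFinB lee_fin /F.
  have le_pi y : 0 < y <= pi -> expR ((1 - a) * ln y) <= expR ((1 - a) * ln pi).
    by move=> /andP[y_gt0 ypi]; rewrite ler_expR ler_wpM2l ?(ltW a10)// ler_ln ?posrE ?pi_gt0.
  have := le_pi (e * (c - pi)); rewrite c0 cpi => /(_ isT).
  have := le_pi (e * (d - pi)); rewrite d0 dpi => /(_ isT).
  have := expR_ge0 ((1 - a) * ln (e * (c - pi))); have := expR_ge0 ((1 - a) * ln (e * (d - pi))).
  rewrite -mulrBr ler_pdivlMr// mulrAC mulfVK ?gt_eqF//.
  have : (e - 1) * (e + 1) = 0 by transitivity (e ^+ 2 - 1); [ring|rewrite e2 subrr].
  move=> /eqP; rewrite mulf_eq0 subr_eq0 addr_eq0 => /orP[/eqP->|/eqP->]; lra.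
- apply: continuous_in_subspaceT => s; rewrite inE => /y0 ys.
  have cy : {for s, continuous (fun s => e * (s - pi))}.
    by apply: cvgM; [exact: cvg_cst|apply: cvgB; [exact: cvg_id|exact: cvg_cst]].
  have cl := cvg_comp _ _ cy (@continuous_ln R _ ys).
  have cal : (- a * ln (e * (x - pi))) @[x --> s] --> - a * ln (e * (s - pi)).
    by apply: cvgM; [exact: cvg_cst|exact: cl].
  exact: (cvg_comp _ _ cal (@continuous_expR R _)).
- split.
  + by move=> s /subset_itv_oo_cc; exact: dF1.
  + exact/cvg_at_right_filter/cF.
  + exact/cvg_at_left_filter/cF.
- move=> s /subset_itv_oo_cc /dF h; rewrite derive1E; exact: derive_val.
Qed.

End Distance.

Section PowerIntegral.
Context {R : realType}.
Implicit Types (s t x a : R).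
Local Notation mu := (@lebesgue_measure R).

Lemma measurable_expR_ln (g : R -> R) a : measurable_fun setT g ->
  measurable_fun setT (fun s => expR (- a * ln (g s))).
Proof.
move=> mg; apply: (measurableT_comp (@measurable_expR R)).
by apply: measurable_funM => //; exact: (measurableT_comp (@measurable_ln R)).
Qed.

(** Exhaust the interval by the complements of shrinking neighbourhoods of [pi],
    on which the integrals are bounded uniformly. *)
Lemma power_integral_finite a : a < 1 ->
  (\int[mu]_(s in `[0%R, (2 * pi)%R]) (expR (- a * ln `|s - pi|)%R)%:E < +oo)%E.
Proof.
move=> a1; have pi0 := pi_gt0 R.
pose g (s : R) := (expR (- a * ln `|s - pi|))%:E.
have mg : measurable_fun setT g.
  apply/measurable_EFinP; apply: measurable_expR_ln.
  apply: (measurableT_comp (@normr_measurable R setT)).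
  by apply: measurable_funB; [exact: measurable_id|exact: measurable_cst].
(* the shift by 2 keeps every [e n] below [pi], so that no interval is empty *)
pose e n : R := pi / n.+2%:R.
have e0 n : 0 < e n by rewrite divr_gt0.
have epi n : e n < pi by rewrite ltr_pdivrMr// ltr_pMr// ltr1n.
pose A n : set R := `[0, pi - e n]%classic.
pose B n : set R := `[pi + e n, 2 * pi]%classic.
pose F n := A n `|` B n.
pose M := (expR ((1 - a) * ln pi) / (1 - a) : R).
have FM n : (\int[mu]_(s in F n) g s <= (M + M)%:E)%E.
  rewrite ge0_integral_setU//=; [|exact: measurable_itv|exact: measurable_itv| | |].
  - rewrite EFinD; apply: leeD.
    + rewrite (_ : (\int[mu]_(s in A n) g s)%E =
        (\int[mu]_(s in A n) (expR (- a * ln (-1 * (s - pi))))%:E)%E); last first.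
        apply: eq_integral => s; rewrite /A inE/= in_itv/= => /andP[_ sp].
        by rewrite /g mulN1r ler0_norm// subr_le0 (le_trans sp)// gerBl ltW.
      apply: integral_power_off_pi => //; rewrite ?sqrrN ?expr1n//; have := e0 n; have := epi n; lra.
    + rewrite (_ : (\int[mu]_(s in B n) g s)%E =
        (\int[mu]_(s in B n) (expR (- a * ln (1 * (s - pi))))%:E)%E); last first.
        apply: eq_integral => s; rewrite /B inE/= in_itv/= => /andP[sp _].
        by rewrite /g mul1r ger0_norm// subr_ge0 (le_trans _ sp)// lerDl ltW.
      apply: integral_power_off_pi => //; rewrite ?expr1n//; have := e0 n; have := epi n; lra.
  - exact: measurable_funTS.
  - by move=> s _; rewrite lee_fin expR_ge0.
  - apply/disj_set2P; apply/seteqP; split=> // s []; rewrite /A /B /=.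
    by rewrite !in_itv/= => /andP[_ s1] /andP[s2 _]; have := e0 n; lra.
have nF : nondecreasing_seq F.
  apply/nondecreasing_seqP => n; rewrite subsetEset => s.
  have en : e n.+1 <= e n by rewrite ler_pM2l// lef_pV2 ?posrE// ler_nat.
  rewrite /F /A /B => -[] /=; rewrite !in_itv/= => /andP[s1 s2]; [left|right];
    apply/andP; split; lra.
have mF n : measurable (F n) by apply: measurableU; exact: measurable_itv.
have cF : (\int[mu]_(s in F n) g s)%E @[n --> \oo] --> (\int[mu]_(s in \bigcup_n F n) g s)%E.
  apply: ge0_nondecreasing_set_cvg_integral => //.
  - by move=> i; exact: measurable_funTS.
  - by move=> i x _; rewrite lee_fin expR_ge0.
apply: (@le_lt_trans _ _ (M + M)%:E); last exact: ltry.
rewrite -[leLHS](@integral_setD1 _ _ pi); first last.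
- exact: measurable_funTS.
- by apply: measurableD => //; exact: measurable_itv.
have -> : `[0, 2 * pi]%classic `\ pi = \bigcup_n F n.
  rewrite /F /A /B; apply/seteqP; split=> s.
    move=> [/=]; rewrite in_itv/= => /andP[s0 s2] /eqP spi.
    have d0 : 0 < `|s - pi| by rewrite normr_gt0 subr_eq0.
    pose n := Num.truncn (pi / `|s - pi|).
    have en : e n <= `|s - pi|.
      rewrite /e ler_pdivrMr// -ler_pdivrMl// mulrC ltW//.
      have /andP[_ h] := truncn_itv (ltW (divr_gt0 pi0 d0)).
      by rewrite (lt_le_trans h)// ler_nat.
    exists n => //; have [sp|sp] := leP s pi.
      left => /=; rewrite in_itv/= s0/=; move: en; rewrite ler0_norm; lra.
    right => /=; rewrite in_itv/= s2 andbT; move: en; rewrite ger0_norm; lra.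
  move=> [n _] [] /=; rewrite !in_itv/= => /andP[s1 s2]; have := e0 n; have := epi n => h1 h2.
    by split; [apply/andP; split; lra|apply/eqP; lra].
  by split; [apply/andP; split; lra|apply/eqP; lra].
by apply: cvge_to_le cF _; apply: nearW.
Qed.

Lemma circle_integral_ge0 (g : R -> \bar R) : measurable_fun setT g -> (forall t, 0 <= g t)%E ->
  (\int[circle_prob]_t g t =
   ((2 * pi)^-1)%R%:E * \int[mu]_(t in `[0%R, (2 * pi)%R]) g t)%E.
Proof. by move=> mg g0; rewrite integral_uniform// subr0. Qed.

Lemma circle_integrable_lebesgue (g : R -> R) : circle_prob.-integrable setT (EFin \o g) ->
  mu.-integrable `[0, 2 * pi] (EFin \o g).
Proof.
move=> /integrableP[mg ig]; apply/integrableP; split; first exact: measurable_funTS.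
move: ig; rewrite circle_integral_ge0//; last exact: measurableT_comp.
by rewrite lte_pdivrMl ?mulr_gt0 ?pi_gt0// mulry gtr0_sg ?mul1e// mulr_gt0 ?pi_gt0.
Qed.

Lemma angle_to_N1_power_integrable a : a < 1 ->
  circle_prob.-integrable setT (EFin \o (fun t => expR (- a * ln (angle_to_N1 (expi t))))).
Proof.
move=> a1.
have mg : measurable_fun setT (fun t : R => expR (- a * ln (angle_to_N1 (expi t)))).
  by apply: measurable_expR_ln; exact: measurable_angle_to_N1.
apply/integrableP; split; first exact/measurable_EFinP.
under eq_integral => t _ do rewrite /= ger0_norm ?expR_ge0//.
rewrite circle_integral_ge0//; last exact/measurable_EFinP.
rewrite lte_mul_pinfty ?lee_fin ?invr_ge0 ?mulr_ge0 ?pi_ge0//.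
apply: le_lt_trans (power_integral_finite a a1).
rewrite le_eqVlt; apply/orP; left; apply/eqP; apply: eq_integral => t.
by rewrite inE/= in_itv/= => tI; rewrite angle_to_N1_expi.
Qed.

Lemma measurable_near_N1 (e : R) : measurable [set t : R | 0 < angle_to_N1 (expi t) < e].
Proof.
rewrite (_ : mkset _ = (fun t : R => angle_to_N1 (expi t)) @^-1` `]0, e[%classic).
  rewrite -[X in measurable X]setTI.
  by apply: measurable_angle_to_N1 => //; exact: measurable_itv.
by apply/seteqP; split=> t; rewrite /= in_itv.
Qed.

Lemma circle_prob_near_N1 (e : R) : 0 < e <= pi ->
  circle_prob [set t : R | 0 < angle_to_N1 (expi t) < e] = (e / pi)%:E.
Proof.
move=> /andP[e0 epi]; have pi0 := pi_gt0 R.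
set E := [set t : R | _].
have mE : measurable E := measurable_near_N1 e.
rewrite -[LHS]mul1e -integral_cst//= integral_mkcond/=.
rewrite circle_integral_ge0; last 2 first.
- by apply/measurable_restrict => //; exact: measurable_cst.
- by move=> t; rewrite erestrict_ge0.
rewrite -integral_mkcondr integral_cst ?mul1e; last first.
  by apply: measurableI => //; exact: measurable_itv.
have -> : `[0, 2 * pi]%classic `&` E = `]pi - e, pi + e[%classic `\ pi.
  apply/seteqP; split=> t.
    move=> [/=]; rewrite in_itv/= => tI; rewrite /E/= angle_to_N1_expi// normr_gt0 subr_eq0.
    by move=> /andP[/eqP tpi te]; split=> //; rewrite /= in_itv/= -ltr_distl.
  move=> [/=]; rewrite in_itv/= => /andP[t1 t2] /eqP tpi.
  have tI : 0 <= t <= 2 * pi by apply/andP; split; lra.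
  split; first by rewrite /= in_itv.
  by rewrite /E/= angle_to_N1_expi// normr_gt0 subr_eq0 tpi ltr_distl t1 t2.
rewrite measureD//=.
- rewrite setI1 mem_set/=; last by rewrite in_itv/=; apply/andP; split; lra.
  rewrite lebesgue_measure_set1 lebesgue_measure_itv/= lte_fin.
  rewrite ifT; last lra.
  rewrite sube0 -EFinB -EFinM; congr EFin.
  by move: pi0; move: (pi : R) => q q0; field; rewrite gt_eqF.
- by rewrite lebesgue_measure_itv/= lte_fin ifT ?ltry//; lra.
Qed.

End PowerIntegral.

(** * Bounds on an H_2 norm from bounds off a null set *)

Section NonMeasurableIntegral.
Context d (T : measurableType d) (R : realType) (P : {measure set T -> \bar R}).
Local Open Scope ereal_scope.
Import HBNNSimple.

(** The integral is the supremum of the integrals of the simple functions below,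
    which makes it monotone whether or not the functions are measurable. *)
Lemma ge0_le_integralT (f g : T -> \bar R) : (forall x, 0 <= f x) ->
  (forall x, f x <= g x) -> \int[P]_x f x <= \int[P]_x g x.
Proof.
move=> f0 fg.
have g0 x : 0 <= g x := le_trans (f0 x) (fg x).
rewrite !ge0_integralTE//; apply: le_ereal_sup => _ [h hf <-] /=.
by exists h => // x; exact: le_trans (hf x) (fg x).
Qed.

(** Raising [g] to infinity on [N] makes it dominate [f] everywhere and does not
    change its integral. *)
Lemma le_integral_off_negligible (N : set T) (f g : T -> \bar R) :
  measurable N -> P N = 0 -> (forall x, 0 <= f x) -> (forall x, 0 <= g x) ->
  measurable_fun setT g -> (forall x, ~ N x -> f x <= g x) ->
  \int[P]_x f x <= \int[P]_x g x.
Proof.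
move=> mN PN f0 g0 mg fg.
pose h x := g x + (cst +oo \_ N) x.
have h0 x : 0 <= h x by apply: adde_ge0 => //; apply: erestrict_ge0 => y _; rewrite leey.
have mh : measurable_fun setT h.
  by apply: emeasurable_funD => //; apply/measurable_restrict => //; exact: measurable_cst.
have hN x : (setT `\` N) x -> h x = g x.
  by move=> [_ Nx]; rewrite /h patchE memNset// adde0.
apply: (@le_trans _ _ (\int[P]_x h x)).
  apply: ge0_le_integralT => // x; have [Nx|Nx] := pselect (N x).
    by rewrite /h patchE mem_set//= addey ?leey// gt_eqF// (lt_le_trans _ (g0 x)).
  by rewrite hN//; exact: fg.
have -> := ge0_negligible_integral mN measurableT mh (fun x _ => h0 x) PN.
have -> := ge0_negligible_integral mN measurableT mg (fun x _ => g0 x) PN.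
by rewrite (eq_integral g)// => x; rewrite inE => /hN.
Qed.

Lemma ge_integral_off_negligible (N : set T) (f g : T -> \bar R) :
  measurable N -> P N = 0 -> (forall x, 0 <= f x) -> (forall x, 0 <= g x) ->
  measurable_fun setT g -> (forall x, ~ N x -> g x <= f x) ->
  \int[P]_x g x <= \int[P]_x f x.
Proof.
move=> mN PN f0 g0 mg gf.
have -> := ge0_negligible_integral mN measurableT mg (fun x _ => g0 x) PN.
rewrite setTD integral_mkcond.
apply: ge0_le_integralT => x; first exact: erestrict_ge0.
by rewrite patchE; case: ifPn => // /set_mem; exact: gf.
Qed.
End NonMeasurableIntegral.

Section NormH2.
Context {R : realType}.

Lemma normc_ge0 (z : R[i]) : 0 <= Normc.normc z.
Proof. by case: z => a b; exact: sqrtr_ge0. Qed.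

(** The majorant [k] makes the norm finite; otherwise [fine] would send it to 0. *)
Lemma normH2_ge (h : R[i] -> R[i]) (N : set R) (g k : R -> R) :
  measurable N -> circle_prob N = 0%E ->
  circle_prob.-integrable setT (EFin \o g) -> circle_prob.-integrable setT (EFin \o k) ->
  (forall t, 0 <= g t) -> (forall t, 0 <= k t) ->
  (forall t, ~ N t -> g t <= Normc.normc (boundary h t) ^+ 2 <= k t) ->
  \int[circle_prob]_t g t <= fine (normH2 h) ^+ 2.
Proof.
move=> mN PN ig ik g0 k0 gk.
set b := fun t => Normc.normc (boundary h t).
pose I := (\int[circle_prob]_t (b t ^+ 2)%:E)%E.
have NI : (normH2 h `^ 2%R)%E = I.
  rewrite /normH2 poweR_Lnorm//; apply: eq_integral => t _.
  by rewrite -[LHS]/(`|b t|%R%:E `^ 2%R)%E poweR_EFin ger0_norm ?normc_ge0// powR_mulrn ?normc_ge0.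
have Nfin : fine (normH2 h) ^+ 2 = fine I.
  by rewrite -NI fine_poweR powR_mulrn// fine_ge0// Lnorm_ge0.
have Ifin : I \is a fin_num.
  rewrite ge0_fin_numE; last by apply: integral_ge0 => t _; rewrite lee_fin sqr_ge0.
  apply: le_lt_trans (integrable_lty measurableT ik).
  apply: (le_integral_off_negligible _ _ _ circle_prob N (fun t => (b t ^+ 2)%:E) (EFin \o k)) => //.
  - by move=> t; rewrite lee_fin sqr_ge0.
  - exact: measurable_int ik.
  - by move=> t /gk /andP[_]; rewrite lee_fin.
have gfin := integrable_fin_num measurableT ig.
rewrite Nfin /Rintegral -lee_fin fineK// [leRHS]fineK//.
apply: (ge_integral_off_negligible _ _ _ circle_prob N (fun t => (b t ^+ 2)%:E) (EFin \o g)) => //.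
- by move=> t; rewrite lee_fin sqr_ge0.
- exact: measurable_int ig.
- by move=> t /gk /andP[+ _]; rewrite lee_fin.
Qed.

End NormH2.

(** * The peaked functions *)

Definition near_N1 {R : realType} (e : R) (z : R[i]) : bool := 0 < angle_to_N1 z < e.

Definition log_peak {R : realType} (sigma e : R) (z : R[i]) : R :=
  - sigma * ln (angle_to_N1 z) + (near_N1 e z)%:R.

(** The function [d ^ (- sigma)], multiplied by [exp 1] where [0 < d < e]; since
    that range is empty for [e = 0], the unaltered function is a member of the
    family.  The power is written with [expR] to make it positive, and its
    logarithm exact, at [d = 0] too. *)
Definition peak {R : realType} (sigma e : R) (z : R[i]) : R := expR (log_peak sigma e z).

Section Family.
Context {R : realType}.
Implicit Types (s t x a e sigma : R).
Local Notation mu := (@lebesgue_measure R).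
Local Notation P := (@circle_prob R).

Lemma ln_peak sigma e z : ln (peak sigma e z) = log_peak sigma e z.
Proof. by rewrite /peak expRK. Qed.

Lemma near_N1_0 (z : R[i]) : near_N1 0 z = false.
Proof. by apply/negbTE/negP => /andP[h1 h2]; have := lt_trans h1 h2; rewrite ltxx. Qed.

Lemma near_N1_indic e t : (near_N1 e (expi t))%:R = \1_[set t : R | near_N1 e (expi t)] t :> R.
Proof.
rewrite indicE; congr (_%:R); congr nat_of_bool.
by apply/idP/idP => [h|/set_mem]; [exact: mem_set|].
Qed.

Lemma measurable_log_peak sigma e : measurable_fun setT (fun t : R => log_peak sigma e (expi t)).
Proof.
apply: measurable_funD.
  apply: measurable_funM => //.
  exact: (measurableT_comp (@measurable_ln R) measurable_angle_to_N1).
under eq_fun do rewrite near_N1_indic.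
by apply: measurable_indic; exact: measurable_near_N1.
Qed.

Lemma measurable_peak sigma e : measurable_fun setT (fun t : R => peak sigma e (expi t)).
Proof. exact: (measurableT_comp (@measurable_expR R) (measurable_log_peak sigma e)). Qed.

Lemma log_peak_le sigma e z : log_peak sigma e z <= - sigma * ln (angle_to_N1 z) + 1.
Proof. by rewrite /log_peak lerD2l; case: near_N1. Qed.

Lemma memLp_peak sigma e q : 0 < q -> sigma * q < 1 -> memLp q (peak sigma e).
Proof.
move=> q0 sq1; rewrite /memLp inE; apply/andP; split; rewrite inE/=.
  exact: measurable_peak.
rewrite /finite_norm unlock /Lnorm; apply: poweR_lty.
have ig := angle_to_N1_power_integrable _ sq1.
have ig' : P.-integrable setT
    (EFin \o (fun t : R => expR q * expR (- (sigma * q) * ln (angle_to_N1 (expi t))))).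
  exact: (@integrableZl _ _ _ P _ measurableT (expR q) _ ig).
apply: le_lt_trans (integrable_lty measurableT ig').
apply: ge0_le_integralT => t; first by rewrite poweR_ge0.
rewrite -[leLHS]/(`|peak sigma e (expi t)|%R%:E `^ q)%E poweR_EFin lee_fin.
rewrite ger0_norm ?expR_ge0// /peak -expRM -expRD ler_expR.
have := log_peak_le sigma e (expi t); rewrite -(ler_pM2r q0); lra.
Qed.

(** From below [log f >= - sigma * log d >= - sigma * pi], and from above
    [log f <= f], which is integrable. *)
Lemma memLp_log_peak sigma e : 0 < sigma < 1 -> memLp 1 (fun z => log_peak sigma e z).
Proof.
move=> /andP[s0 s1]; rewrite /memLp; apply/Lfun1_integrable.
have ig : P.-integrable setT (EFin \o (fun t : R => peak sigma e (expi t))).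
  apply/Lfun1_integrable; apply: memLp_peak => //; lra.
have ic := finite_measure_integrable_cst P (sigma * pi + 1) measurableT.
have := integrableD measurableT ig ic; apply: le_integrable => //.
  by apply/measurable_EFinP; exact: measurable_log_peak.
move=> t _ /=; rewrite lee_fin [leRHS]ger0_norm ?addr_ge0 ?expR_ge0 ?mulr_ge0 ?(ltW s0) ?pi_ge0//.
rewrite /peak; set y := log_peak _ _ _.
have := expR_ge1Dx y.
have : - y <= sigma * pi.
  have /andP[d0 dpi] := angle_to_N1_expi_itv t.
  apply: (@le_trans _ _ (sigma * ln (angle_to_N1 (expi t)))).
    by rewrite /y /log_peak opprD mulNr opprK gerBl.
  rewrite ler_wpM2l ?(ltW s0)//.
  move: d0; rewrite le_eqVlt => /predU1P[<-|d0]; first by rewrite ln0 ?pi_ge0.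
  exact: le_trans (ltW (ln_sublinear d0)) dpi.
have sp : 0 <= sigma * pi by rewrite mulr_ge0 ?pi_ge0// ltW.
have := expR_ge0 y.
by rewrite ler_norml => *; apply/andP; split; lra.
Qed.

Lemma memS1_peak sigma e : 0 < sigma < 1 -> memS1 (peak sigma e).
Proof.
move=> /[dup] /andP[s0 s1] s01; split.
- by apply: memLp_peak => //; rewrite mulr1.
- by apply: (aeW P) => t; rewrite expR_gt0.
- by rewrite (_ : (fun z => _) = log_peak sigma e); [exact: memLp_log_peak|apply/funext => z; rewrite ln_peak].
Qed.

Lemma ln_lipschitz (m a b : R) : 0 < m -> m <= a -> m <= b -> `|ln a - ln b| <= `|a - b| / m.
Proof.
move=> m0; wlog ab : a b / a <= b => [H ma mb|].
  have [ab|/ltW ba] := leP a b; first exact: H.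
  by rewrite distrC [in leRHS]distrC; exact: H.
move=> ma mb; have a0 : 0 < a := lt_le_trans m0 ma.
have b0 : 0 < b := lt_le_trans m0 mb.
rewrite ler0_norm ?subr_le0 ?ler_ln// ler0_norm ?subr_le0// !opprB.
rewrite -ln_div ?posrE//.
have h : -1 < (b - a) / a by rewrite ltr_pdivlMr//; lra.
apply: le_trans (_ : (b - a) / a <= _).
  have -> : b / a = 1 + (b - a) / a by field; rewrite gt_eqF.
  exact: le_ln1Dx.
by rewrite ler_wpM2l ?subr_ge0// lef_pV2.
Qed.

(** Near such a [t] the distance [|s - pi|] stays above half its value at [t], and
    the indicator of the arc is constant. *)
Lemma log_peak_lipschitz sigma e t : 0 < sigma -> 0 < t < 2 * pi -> t != pi -> `|t - pi| != e ->
  \forall s \near t, `|log_peak sigma e (expi s) - log_peak sigma e (expi t)| <=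
    (sigma * (2 / `|t - pi|)) * `|s - t|.
Proof.
move=> s0 /andP[t0 t2pi] tpi te.
have d0 : 0 < `|t - pi| by rewrite normr_gt0 subr_eq0.
have cd : `|s - pi| @[s --> t] --> `|t - pi|.
  by apply: cvg_norm; apply: cvgB; [exact: cvg_id|exact: cvg_cst].
have near_e : \forall s \near t, (`|s - pi| < e) = (`|t - pi| < e).
  move: te; rewrite neq_lt => /orP[te|te].
    by rewrite te; exact: cvgr_lt cd _ te.
  rewrite ltNge (ltW te)/=; apply: filterS (cvgr_gt _ cd _ te) => s es.
  by rewrite ltNge ltW.
near=> s.
have sI : 0 <= s <= 2 * pi.
  by apply/andP; split; apply: ltW; near: s; [exact: lt_nbhsr|exact: lt_nbhsl].
have sE : near_N1 e (expi s) = near_N1 e (expi t).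
  rewrite /near_N1 !angle_to_N1_expi//; last by rewrite !ltW.
  have -> : 0 < `|s - pi| by near: s; exact: cvgr_gt cd _ d0.
  by rewrite d0/=; near: s.
rewrite /log_peak sE.
rewrite opprD addrACA subrr addr0 -mulrBr normrM normrN (gtr0_norm s0) -mulrA ler_pM2l//.
rewrite !angle_to_N1_expi//; last by rewrite !ltW.
have m0 : 0 < `|t - pi| / 2 by rewrite divr_gt0.
apply: le_trans (ln_lipschitz _ _ _ m0 _ _) _.
- by apply: ltW; near: s; apply: (cvgr_gt _ cd); lra.
- lra.
rewrite invf_div mulrC ler_wpM2l ?divr_ge0//.
apply: le_trans (ler_dist_dist _ _) _.
by rewrite opprB addrA subrK.
Unshelve. all: by end_near. Qed.

End Family.

(** * Distances between the peaked functions *)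

(** The angles at which the boundary values are not controlled: the ends of the
    interval, the singularity, and the ends of the altered arc.  Everything
    outside the interval is added, as the probability lives on the real line. *)
Definition exceptional {R : realType} (e : R) : set R :=
  ~` `]0, 2 * pi[%classic `|` [set pi; pi + e; pi - e].

Section Norms.
Context {R : realType}.
Implicit Types (s t x a e sigma : R).
Local Notation mu := (@lebesgue_measure R).
Local Notation P := (@circle_prob R).

Lemma circle_prob_finite_trace (N : set R) : measurable N ->
  finite_set (`[0, 2 * pi]%classic `&` N) -> P N = 0%E.
Proof.
move=> mN fN.
rewrite -[LHS]mul1e -integral_cst//= integral_mkcond/=.
rewrite circle_integral_ge0; last 2 first.
- by apply/measurable_restrict => //; exact: measurable_cst.
- by move=> t; rewrite erestrict_ge0.
rewrite -integral_mkcondr integral_cst ?mul1e; last first.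
  by apply: measurableI => //; exact: measurable_itv.
have := countable_lebesgue_measure0 (finite_set_countable fN) => /= ->.
by rewrite mule0.
Qed.

Lemma measurable_exceptional e : measurable (exceptional e).
Proof.
apply: measurableU; first by apply: measurableC; exact: measurable_itv.
by do 2?apply: measurableU; exact: measurable_set1.
Qed.

Lemma circle_prob_exceptional e : P (exceptional e) = 0%E.
Proof.
apply: circle_prob_finite_trace; first exact: measurable_exceptional.
apply: (@sub_finite_set _ _ ([set 0; 2 * pi] `|` [set pi; pi + e; pi - e])); last first.
  by rewrite finite_setU; split; [exact: finite_set2|exact: finite_set3].
move=> t [] /= /[!in_itv]/= /andP[t0 t2] [/= /[!in_itv]/= /negP|]; last by right.
rewrite negb_and -!leNgt => /orP[t0'|t2'].
  by left; left; apply/eqP; rewrite eq_le t0 t0'.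
by left; right; apply/eqP; rewrite eq_le t2 t2'.
Qed.

Lemma not_exceptional e t : ~ exceptional e t ->
  [/\ 0 < t < 2 * pi, t != pi & `|t - pi| != e].
Proof.
move=> /not_orP[/contrapT /= /[!in_itv]/= tI /not_orP[/not_orP[/eqP t1 /eqP t2] /eqP t3]].
split => //; apply/eqP => te; move: t2 t3; rewrite -te.
by case: (ger0P (t - pi)) => _; rewrite ?subrKC ?eqxx// opprK subrKC eqxx.
Qed.

Lemma integral_near_N1 e : 0 < e <= pi ->
  (\int[P]_t ((near_N1 e (expi t))%:R : R)%:E = (e / pi)%:E)%E.
Proof.
move=> eI; rewrite -(circle_prob_near_N1 _ eI).
under eq_integral do rewrite near_N1_indic.
by rewrite integral_indic ?setIT//; exact: measurable_near_N1.
Qed.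

Lemma log_peak_sub sigma e z : log_peak sigma 0 z - log_peak sigma e z = - (near_N1 e z)%:R.
Proof.
by rewrite /log_peak near_N1_0 addr0 opprD addrA subrr sub0r.
Qed.

Lemma normLp_log_peak sigma e : 0 < e <= pi ->
  normLp 1 (fun z => ln (peak sigma 0 z) - ln (peak sigma e z)) = (e / pi)%:E.
Proof.
move=> eI; rewrite /normLp Lnorm1 -integral_near_N1//; apply: eq_integral => t _.
by rewrite /= !ln_peak log_peak_sub normrN ger0_norm.
Qed.

Definition arc_width (k : nat) : R := expR (- k%:R).

Lemma arc_width_itv k : 0 < arc_width k <= pi.
Proof.
rewrite expR_gt0/= (@le_trans _ _ 1)//; first by rewrite -expR0 ler_expR oppr_le0.
by have := @pi_ge2 R; lra.
Qed.

Lemma arc_width_cvg0 : arc_width k @[k --> \oo] --> 0.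
Proof.
apply/cvgrPdist_lt => e e0; near=> k.
rewrite sub0r normrN ger0_norm ?expR_ge0// /arc_width expRN.
rewrite -(invrK e) ltf_pV2 ?posrE ?invr_gt0 ?expR_gt0//.
apply: lt_le_trans (expR_ge1Dx _).
by rewrite ltr_wpDl//; near: k; exact: nbhs_infty_gtr.
Unshelve. all: by end_near. Qed.

(** The altered arcs shrink to the empty set, since the point -1 itself is
    excluded from them; domination is by [exp 1] times the unaltered function. *)
Lemma normLp_peak_cvg sigma : 0 < sigma < 1 ->
  normLp 1 (fun z => peak sigma 0 z - peak sigma (arc_width k) z) @[k --> \oo] --> 0%E.
Proof.
move=> /andP[s0 s1].
have mf e : measurable_fun setT (EFin \o (fun t : R => peak sigma e (expi t))).
  by apply/measurable_EFinP; exact: measurable_peak.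
have ig : P.-integrable setT (EFin \o (fun t : R => expR 1 * peak sigma 0 (expi t))).
  apply: (@integrableZl _ _ _ P _ measurableT (expR 1) (EFin \o (fun t => peak sigma 0 (expi t)))).
  by apply/Lfun1_integrable; apply: memLp_peak => //; rewrite mulr1.
have fk t : (EFin (peak sigma (arc_width k) (expi t))) @[k --> \oo] --> (peak sigma 0 (expi t))%:E.
  apply: cvg_near_cst.
  have [d0|d0] := ltP 0 (angle_to_N1 (expi t)); last first.
    by apply: nearW => k; rewrite /peak /log_peak /near_N1 !(ltNge 0) d0.
  apply: filterS (cvgr_lt _ arc_width_cvg0 _ d0) => k kd.
  by rewrite /peak /log_peak /near_N1 d0/= ltNge (ltW kd) ltNge (ltW d0).
have fle t k : (`|(peak sigma (arc_width k) (expi t))%:E| <= (expR 1 * peak sigma 0 (expi t))%:E)%E.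
  rewrite lee_fin ger0_norm ?expR_ge0// /peak -expRD ler_expR.
  have := log_peak_sub sigma (arc_width k) (expi t).
  have : (near_N1 (arc_width k) (expi t))%:R <= 1 :> R by case: near_N1.
  lra.
have [_ + _] := @dominated_convergence _ _ _ P _ measurableT
  (fun k t => (peak sigma (arc_width k) (expi t))%:E) (fun t => (peak sigma 0 (expi t))%:E)
  (fun t => (expR 1 * peak sigma 0 (expi t))%:E)
  (fun k => mf (arc_width k)) (mf 0) (aeW P (fun t _ => fk t)) ig
  (aeW P (fun t k _ => fle t k)).
apply: cvg_trans; apply: near_eq_cvg; apply: nearW => k.
rewrite /normLp Lnorm1; apply: eq_integral => t _ /=.
by rewrite distrC.
Qed.

(** On the arc [sqrt f_k = sqrt e * sqrt f] with [sqrt e - 1 >= 1 / 2], and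
    [f >= w_k ^ (- sigma) = exp (sigma * k)] because [d < w_k = exp (- k)]. *)
Lemma normH2_peak_ge sigma k : 0 < sigma < 1 ->
  4^-1 * expR (sigma * k%:R) * (arc_width k / pi) <=
  fine (normH2 (fun z => spectral_factor (peak sigma 0) z -
                         spectral_factor (peak sigma (arc_width k)) z)) ^+ 2.
Proof.
move=> /[dup] s01 /andP[s0 s1].
pose g (t : R) := 4^-1 * expR (sigma * k%:R) * (near_N1 (arc_width k) (expi t))%:R.
pose c (t : R) := (4 * expR 1) * peak sigma 0 (expi t).
have nonneg : 0 <= 4^-1 * expR (sigma * k%:R) by rewrite mulr_ge0 ?expR_ge0// invr_ge0.
have inear : P.-integrable setT (fun t => ((near_N1 (arc_width k) (expi t))%:R : R)%:E).
  under [X in integrable _ _ X]eq_fun do rewrite near_N1_indic.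
  by apply: integrable_indic => //; exact: measurable_near_N1.
have ig : P.-integrable setT (EFin \o g) by exact: (integrableZl measurableT _ inear).
have ic : P.-integrable setT (EFin \o c).
  apply: (@integrableZl _ _ _ P _ measurableT (4 * expR 1) (EFin \o (fun t => peak sigma 0 (expi t)))).
  by apply/Lfun1_integrable; apply: memLp_peak => //; rewrite mulr1.
have iln e : mu.-integrable `[0, 2 * pi] (EFin \o (fun s => ln (peak sigma e (expi s)))).
  apply: circle_integrable_lebesgue.
  apply/Lfun1_integrable; have [_ _] := memS1_peak sigma e s01; exact.
rewrite (_ : _ * (arc_width k / pi) = \int[P]_t g t); last first.
  rewrite /Rintegral.
  under eq_integral do rewrite EFinM.
  rewrite integralZl// integral_near_N1 ?arc_width_itv//.
apply: (normH2_ge _ (exceptional (arc_width k)) g c) => //.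
- exact: measurable_exceptional.
- exact: circle_prob_exceptional.
- by move=> t; rewrite mulr_ge0.
- by move=> t; rewrite !mulr_ge0 ?expR_ge0.
move=> t /not_exceptional[tI tpi te].
have te0 : `|t - pi| != 0 by rewrite normr_eq0 subr_eq0.
have lip e : `|t - pi| != e -> \forall s \near t,
    `|ln (peak sigma e (expi s)) - ln (peak sigma e (expi t))| <=
    (sigma * (2 / `|t - pi|)) * `|s - t|.
  by move=> te'; apply: filterS (log_peak_lipschitz sigma e t s0 tI tpi te') => s; rewrite !ln_peak.
have /andP[lo up] := boundary_sub (peak sigma 0) (peak sigma (arc_width k)) t _ tI
  (iln 0) (iln (arc_width k)) (lip _ te0) (lip _ te).
have {lo} lo := lerXn2r 2 (normr_ge0 _) (normc_ge0 _) lo.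
have {up} up := lerXn2r 2 (normc_ge0 _) (addr_ge0 (expR_ge0 _) (expR_ge0 _)) up.
have sq (x : R) : expR (x / 2) ^+ 2 = expR x.
  by rewrite -expRM_natl; congr expR; field.
have lE := log_peak_sub sigma (arc_width k) (expi t).
rewrite !ln_peak in lo up.
apply/andP; split.
  apply: le_trans lo; rewrite real_normK ?num_real// /g.
  case nearE : (near_N1 _ _) lE => /= lE; last by rewrite mulr0 sqr_ge0.
  rewrite mulr1 (_ : log_peak sigma (arc_width k) (expi t) = log_peak sigma 0 (expi t) + 1); last lra.
  have : sigma * k%:R <= log_peak sigma 0 (expi t).
    rewrite /log_peak near_N1_0 addr0 mulNr -mulrN ler_pM2l// lerNr.
    move: nearE => /andP[d0 /ltW]; rewrite -ler_ln ?posrE ?expR_gt0//.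
    by rewrite expRK.
  move: (log_peak _ _ _) => v; rewrite -ler_expR => kv.
  have alg (x y : R) : (x - x * y) ^+ 2 = (1 - y) ^+ 2 * x ^+ 2 by ring.
  rewrite mulrDl expRD alg sq ler_pM ?expR_ge0//.
  by have := @expR_ge1Dx R (1 / 2); nra.
apply: le_trans up _; rewrite /c -mulrA -expRD.
have le1 : log_peak sigma (arc_width k) (expi t) <= 1 + log_peak sigma 0 (expi t).
  have : (near_N1 (arc_width k) (expi t))%:R <= 1 :> R by case: near_N1.
  lra.
rewrite (_ : 4 = 2 ^+ 2); last by ring.
rewrite -(sq (1 + _)) -exprMn.
rewrite lerXn2r ?nnegrE ?addr_ge0 ?mulr_ge0 ?expR_ge0//.
rewrite [leRHS]mulr_natl [leRHS]mulr2n lerD// ler_expR; lra.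
Qed.
End Norms.

(** * The quotient tends to infinity *)

Theorem theorem1p6 (R : realType) (p : R) (hp : 1 < p)
    (gamma : R) (hgamma : (p - 1) / p < gamma) :
  exists (f : R[i] -> R) (f_ : nat -> R[i] -> R),
    [/\ memS1 f /\ memLp p f,
        forall k, memS1 (f_ k) /\ memLp p (f_ k),
        normLp 1 (fun z => f z - f_ k z) @[k --> \oo] --> 0%E,
        normLp 1 (fun z => ln (f z) - ln (f_ k z)) @[k --> \oo] --> 0%E
      & (fine (normH2 (fun z => spectral_factor f z -
                                spectral_factor (f_ k) z)) ^+ 2
         / fine (normLp 1 (fun z => ln (f z) - ln (f_ k z))) `^ gamma)
          @[k --> \oo] --> +oo].
Proof.
have p0 : 0 < p by rewrite (lt_trans ltr01).
have pi0 := pi_gt0 R.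
have [sigma [s0 sp sg]] : exists sigma : R, [/\ 0 < sigma, sigma * p < 1 & 1 - gamma < sigma].
  (* the midpoint between max 0 (1 - gamma) and 1 / p *)
  have pV : 1 - gamma < p^-1.
    by move: hgamma; rewrite mulrBl mul1r divff ?gt_eqF//; lra.
  exists ((Num.max 0 (1 - gamma) + p^-1) / 2).
  have pV0 : 0 < p^-1 by rewrite invr_gt0.
  have m1 : Num.max 0 (1 - gamma) < p^-1 by rewrite gt_max pV0 pV.
  have m0 : 0 <= Num.max 0 (1 - gamma) by rewrite le_max lexx.
  have mg : 1 - gamma <= Num.max 0 (1 - gamma) by rewrite le_max lexx orbT.
  split; [lra| |lra].
  by rewrite -ltr_pdivlMr// mul1r; lra.
have s01 : 0 < sigma < 1.
  by rewrite s0/=; apply: lt_trans sp; rewrite ltr_pMr.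
exists (peak sigma 0), (fun k => peak sigma (arc_width k)); split.
- by split; [exact: memS1_peak|exact: memLp_peak].
- by move=> k; split; [exact: memS1_peak|exact: memLp_peak].
- exact: normLp_peak_cvg.
- under eq_cvg => k do rewrite (normLp_log_peak _ _ (arc_width_itv k)).
  apply: cvg_EFin; first exact: nearW.
  rewrite -(mul0r pi^-1); apply: cvgM; [exact: arc_width_cvg0|exact: cvg_cst].
pose b := sigma + gamma - 1.
have b0 : 0 < b by rewrite /b; lra.
pose C : R := 4^-1 * expR ((gamma - 1) * ln pi).
have C0 : 0 < C by rewrite mulr_gt0 ?invr_gt0 ?expR_gt0.
apply: (@ger_cvgy _ _ _ _ (fun k : nat => C * (b * k%:R))); last first.
  apply/cvgryPge => A.
  have /cvgryPge/(_ (A / (C * b))) h := @cvgr_idn R; apply: filterS h => k.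
  by rewrite ler_pdivrMr ?(mulr_gt0 C0)// [_ * (C * b)]mulrC -mulrA.
apply: nearW => k; rewrite normLp_log_peak ?arc_width_itv//.
rewrite -[fine _%:E]/(arc_width k / pi) ler_pdivlMr; last first.
  by rewrite powR_gt0// divr_gt0// expR_gt0.
apply: le_trans (normH2_peak_ge sigma k s01).
have -> : arc_width k / pi = expR (- k%:R - ln (pi : R)).
  by rewrite expRB [expR (ln _)]lnK ?posrE.
(* the powers of w_k = exp (- k) in the two sides differ by exp (b * k) *)
have -> : 4^-1 * expR (sigma * k%:R) * expR (- k%:R - ln pi) =
    C * expR (b * k%:R) * expR ((- k%:R - ln pi) * gamma).
  by rewrite /C -!mulrA -!expRD; congr (_ * expR _); rewrite /b; ring.
rewrite -expRM ler_wpM2r ?expR_ge0// ler_pM2l//.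
by apply: le_trans (expR_ge1Dx _); rewrite lerDr.
Qed.
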